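(* Let $A$ and $B$ be finite sets with $A \approx B$, let $\mathcal{U}$ be an $A$-enumerator and $\mathcal{V}$ a $B$-enumerator. Then there exists a unique homomorphism $\pi : \mathcal{U} \to \mathcal{V}$, and $\pi$ maps $\mathcal{U}$ bijectively onto $\mathcal{V}$. Moreover, $\pi(A) = B$.
   Context: A set $E$ is defined to be finite if $\mathcal{P}(E)$ is the only subset $\mathcal{S}$ of the power set $\mathcal{P}(E)$ such that $\varnothing \in \mathcal{S}$ and $F \cup \{e\} \in \mathcal{S}$ whenever $F \in \mathcal{S}$, $F \neq E$ and $e \in E \setminus F$ (this is equivalent to the usual notion of finiteness). Write $A \approx B$ if there exists a bijective mapping $A \to B$. For $\mathcal{U} \subset \mathcal{P}(E)$ let $\mathcal{U}^p$ be the set of those elements of $\mathcal{U}$ which are proper subsets of $E$. A subset $\mathcal{U}$ of $\mathcal{P}(E)$ is an $E$-selector if $\varnothing \in \mathcal{U}$ and for each $U \in \mathcal{U}^p$ there exists a unique element $e \in E \setminus U$ such that $U \cup \{e\} \in \mathcal{U}$; for such $U$ and $e$ put $\mathsf{s}_{\mathcal{U}}(U) = U \cup \{e\}$. If $\mathcal{U}$ is an $E$-selector then a subset $\mathcal{V}$ of $\mathcal{U}$ is invariant if $\varnothing \in \mathcal{V}$ and $\mathsf{s}_{\mathcal{U}}(V) \in \mathcal{V}$ for all $V \in \mathcal{V}^p$. An $E$-selector $\mathcal{U}$ is minimal if the only invariant subset of $\mathcal{U}$ is $\mathcal{U}$ itself. An $E$-enumerator is a minimal $E$-selector which contains $E$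 as an element. If $\mathcal{U}$ is an $A$-enumerator and $\mathcal{V}$ a $B$-enumerator, then a mapping $\pi : \mathcal{U} \to \mathcal{V}$ is a homomorphism if $\pi(\varnothing) = \varnothing$, $\pi(\mathcal{U}^p) \subset \mathcal{V}^p$ and $\pi(\mathsf{s}_{\mathcal{U}}(U)) = \mathsf{s}_{\mathcal{V}}(\pi(U))$ for all $U \in \mathcal{U}^p$ (where $\mathcal{U}^p$ is formed relative to $A$ and $\mathcal{V}^p$ relative to $B$). *)

(* Defs.v *)
From mathcomp Require Import all_boot.
From mathcomp Require Import boolp classical_sets functions.

Set Implicit Arguments.
Unset Strict Implicit.
Unset Printing Implicit Defensive.

Local Open Scope classical_set_scope.

(* The ground set is a type [E], so that the power set P(E) is [set E] and
   [E], seen as one of its own subsets, is [setT]. *)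

Section Enumerators.
Variable E : Type.
Implicit Types (X F : set E) (S U V : set (set E)).

Definition finite : Prop :=
  forall S, S set0 ->
    (forall F e, S F -> F <> setT -> ~ F e -> S (F `|` [set e])) ->
  S = setT.

Definition proper_part U : set (set E) := [set X | U X /\ X `<` setT].

Definition selector U : Prop :=
  U set0 /\
  forall X, proper_part U X -> exists! e, ~ X e /\ U (X `|` [set e]).

(* When [U] is a selector and [X] is in [proper_part U], the set joined to [X]
   is the singleton of the unique [e] given by [selector].  Other values of
   [succ] are not meaningful. *)
Definition succ U X : set E := X `|` [set e | ~ X e /\ U (X `|` [set e])].

Definition invariant U V : Prop :=
  [/\ V `<=` U, V set0 & forall X, proper_part V X -> V (succ U X)].

Definition minimal U : Prop := forall V, invariant U V -> V = U.

Definition enumerator U : Prop := [/\ selector U, minimal U & U setT].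

End Enumerators.

Definition equipotent (A B : Type) : Prop := exists f : A -> B, bijective f.

(* A mapping U -> V is a function [set A -> set B] sending [U] into [V]; only
   its values on [U] are relevant. *)
Definition homomorphism (A B : Type) (U : set (set A)) (V : set (set B))
    (pi : set A -> set B) : Prop :=
  [/\ set_fun U V pi,
      pi set0 = set0,
      set_fun (proper_part U) (proper_part V) pi &
      forall X, proper_part U X -> pi (succ U X) = succ V (pi X)].

(* Main.v *)
Require Import Defs.
From mathcomp Require Import all_boot.
From mathcomp Require Import boolp classical_sets functions cardinality.

(** An enumerator is a chain of subsets, from the empty set to the whole ground
    set, in which each member arises from the previous one by adding a single
    element.  Minimality makes this precise: the members reached from the empty
    set by iterating the successor form an invariant subset, hence all of the
    enumerator.  So the member reached after [n] steps has exactly [n] elements,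
    and a member is determined by its cardinality ([enumerator_card_inj]).

    The homomorphism is therefore forced to be the map sending a member [X] of
    [U] to the member of [V] with as many elements as [X].  Such a member exists
    ([enumerator_card_partner]), by induction along [U]: as long as [X] is
    proper, so is its partner, since a partner equal to [B] would give [X] the
    cardinality of [A] and so make it equal to [A]; both can then be enlarged by
    one element.  All properties of this map follow by comparing cardinalities
    of members: it commutes with the successors, it is injective, it is
    surjective because the construction is symmetric in [U] and [V], and it
    sends [A] to [B] because [A] and [B] are equipotent.  Its uniqueness is once
    more induction along [U]. *)

Set Implicit Arguments.
Unset Strict Implicit.
Unset Printing Implicit Defensive.

Local Open Scope classical_set_scope.
Local Open Scope card_scope.

Lemma card_eqS_adjoin (T : Type) (n : nat) (X : set T) (e : T) :
  X #= `I_n -> ~ X e -> X `|` [set e] #= `I_n.+1.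
Proof.
move=> Xn Xe; apply/eq_cardSP; exists e; first by right.
suff -> : (X `|` [set e]) `\ e = X by [].
apply/seteqP; split=> [x [[]//]|x Xx].
by split; [left | move=> xe; apply: Xe; rewrite -xe].
Qed.

Lemma bij_card_setT (A B : Type) (f : A -> B) :
  bijective f -> [set: A] #= [set: B].
Proof.
move=> [g fK gK]; rewrite card_eq_sym.
have <- : f @` setT = setT by apply/seteqP; split=> // y _; exists (g y).
by apply: inj_card_eq => x y _ _; exact: (can_inj fK).
Qed.

Lemma properT_neq (E : Type) (X : set E) : X `<` setT <-> X <> setT.
Proof. by rewrite properEneq; split=> [[/eqP]|/eqP]. Qed.

Section Enumerator.
Variables (E : Type) (U : set (set E)).
Hypothesis enumU : enumerator U.

Lemma enumerator_set0 : U set0. Proof. by case: enumU => -[]. Qed.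

Lemma enumerator_setT : U setT. Proof. by case: enumU. Qed.

Lemma succ_adjoin (X : set E) : U X -> X <> setT ->
  exists e, [/\ ~ X e, U (X `|` [set e]) & succ U X = X `|` [set e]].
Proof.
move=> UX /properT_neq XT; case: enumU => -[_ sel] _ _.
have [e [[Xe UXe] eu]] := sel X (conj UX XT).
exists e; split=> //; congr (_ `|` _).
by apply/seteqP; split=> x /= => [/eu|->].
Qed.

Lemma enumerator_succ (X : set E) : U X -> X <> setT -> U (succ U X).
Proof. by move=> UX XT; have [e [_ UXe ->]] := succ_adjoin UX XT. Qed.

(** Minimality, read as an induction principle. *)
Lemma enumerator_ind (P : set E -> Prop) : P set0 ->
  (forall X, U X -> X <> setT -> P X -> P (succ U X)) ->
  forall X, U X -> P X.
Proof.
move=> P0 PS X UX; case: (enumU) => _ minU _.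
have UP : U `&` P = U.
  apply: minU; split; first by move=> ? [].
    by split; [exact: enumerator_set0 | exact: P0].
  move=> Y [[UY PY] /properT_neq YT].
  by split; [exact: enumerator_succ | exact: PS].
by move: UX; rewrite -UP => -[].
Qed.

Lemma enumerator_iter (X : set E) : U X ->
  exists2 n, X = iter n (succ U) set0 & X #= `I_n.
Proof.
move: X; apply: enumerator_ind; first by exists 0; rewrite // II0.
move=> X UX XT [n Xn cX]; exists n.+1; first by rewrite iterS -Xn.
by have [e [Xe _ ->]] := succ_adjoin UX XT; exact: card_eqS_adjoin.
Qed.

(** The number of steps needed to reach a member from the empty set is its
    number of elements, and that number of steps determines the member. *)
Lemma enumerator_card_inj (X Y : set E) : U X -> U Y -> X #= Y -> X = Y.
Proof.
move=> /enumerator_iter[n -> Xn] /enumerator_iter[m -> Ym] XY.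
suff -> : n = m by [].
apply/card_eq_II; rewrite card_eq_sym in Xn.
exact: card_eq_trans Xn (card_eq_trans XY Ym).
Qed.

End Enumerator.

Section TwoEnumerators.
Variables (A B : Type) (U : set (set A)) (V : set (set B)).
Hypotheses (enumU : enumerator U) (enumV : enumerator V).
Hypothesis cardAB : [set: A] #= [set: B].

Lemma card_eq_setT (X : set A) (Y : set B) : U X -> X #= Y -> Y = setT ->
  X = setT.
Proof.
move=> UX XY YT; apply: (enumerator_card_inj enumU) => //.
  exact: enumerator_setT.
by rewrite YT in XY; apply: card_eq_trans XY _; rewrite card_eq_sym.
Qed.

Lemma card_eq_succ (X : set A) (Y : set B) : U X -> X <> setT ->
  V Y -> Y <> setT -> X #= Y -> succ U X #= succ V Y.
Proof.
move=> UX XT VY YT XY.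
have [n _ Yn] := enumerator_iter enumV VY.
have [a [Xa _ ->]] := succ_adjoin enumU UX XT.
have [b [Yb _ ->]] := succ_adjoin enumV VY YT.
apply: card_eq_trans (card_eqS_adjoin (card_eq_trans XY Yn) Xa) _.
by rewrite card_eq_sym; exact: card_eqS_adjoin.
Qed.

Lemma enumerator_card_partner (X : set A) : U X -> exists2 Y, V Y & X #= Y.
Proof.
move: X; apply: (enumerator_ind enumU).
  by exists set0; [exact: enumerator_set0 | rewrite card_eq0].
move=> X UX XT [Y VY XY].
have YT : Y <> setT by move=> YT; exact/XT/(card_eq_setT UX XY YT).
by exists (succ V Y); [exact: enumerator_succ | exact: card_eq_succ].
Qed.

(** Two homomorphisms agree on the empty set, and agreement passes to
    successors. *)
Lemma homomorphism_unique (pi rho : set A -> set B) :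
  homomorphism U V pi -> homomorphism U V rho ->
  forall X, U X -> rho X = pi X.
Proof.
move=> [_ pi0 _ piS] [_ rho0 _ rhoS].
apply: (enumerator_ind enumU) => [|X UX /properT_neq XT eqX].
  by rewrite pi0.
by rewrite rhoS // piS // eqX.
Qed.

End TwoEnumerators.

Theorem theorem6p3 (A B : Type) (U : set (set A)) (V : set (set B))
    (finA : finite A) (finB : finite B) (AB : equipotent A B)
    (enumU : enumerator U) (enumV : enumerator V) :
  exists pi : set A -> set B,
    [/\ homomorphism U V pi,
        forall rho : set A -> set B,
          homomorphism U V rho -> forall X : set A, U X -> rho X = pi X,
        set_bij U V pi
      & pi setT = setT].
Proof.
have cAB : [set: A] #= [set: B] by case: AB => f; exact: bij_card_setT.
have cBA : [set: B] #= [set: A] by rewrite card_eq_sym.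
have /choice[pi piP] : forall X, exists Y, U X -> V Y /\ X #= Y.
  move=> X; have [UX|nUX] := pselect (U X); last by exists set0.
  by have [Y] := enumerator_card_partner enumU enumV cAB UX; exists Y.
have piV X : U X -> V (pi X) by move=> /piP[].
have piE X Y : U X -> V Y -> X #= Y -> pi X = Y.
  move=> UX VY XY; have [VpiX XpiX] := piP X UX.
  apply: (enumerator_card_inj enumV) => //.
  by rewrite card_eq_sym in XpiX; exact: card_eq_trans XpiX XY.
have piT : pi setT = setT by apply: piE => //; exact: enumerator_setT.
have pi_neqT X : U X -> X <> setT -> pi X <> setT.
  by move=> UX XT piXT; apply/XT/(card_eq_setT enumU cAB UX _ piXT)/(piP _ UX).2.
have pi_hom : homomorphism U V pi.
  split=> //.
  - by apply: piE; rewrite ?card_eq0 //; exact: enumerator_set0.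
  - move=> X [UX /properT_neq XT].
    by split; [exact: piV | apply/properT_neq; exact: pi_neqT].
  - move=> X [UX /properT_neq XT]; have [VpiX XpiX] := piP X UX.
    have piXT := pi_neqT X UX XT.
    apply: piE; [exact: enumerator_succ | exact: enumerator_succ |].
    exact: card_eq_succ.
exists pi; split=> //; first by move=> rho; exact: homomorphism_unique.
split=> //.
- move=> X Y; rewrite !inE => UX UY eqXY; apply: (enumerator_card_inj enumU) => //.
  have [_ XpiX] := piP X UX; have [_ YpiY] := piP Y UY.
  by apply: card_eq_trans XpiX _; rewrite eqXY card_eq_sym.
- move=> Y VY; have [X UX YX] := enumerator_card_partner enumV enumU cBA VY.
  by exists X => //; apply: piE => //; rewrite card_eq_sym.
Qed.
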